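(* Let $\alpha>0$, let $v(n)$ be the velocity at time $n$ of the Slicer Map with parameter $\alpha$, and let $R_\alpha=\sum_{k=1}^\infty\Delta_{2k}(\alpha)$. Let $p\ge1$ be an integer. As $n\to\infty$: (i) if $p\geq 2$ is even, then $\langle v^p(n)\rangle\to1$; (ii) if $p\ge1$ is odd, then $\langle v^p(n)\rangle\to 1-4R_\alpha$ along even $n$, and $\langle v^p(n)\rangle\to-1+4R_\alpha$ along odd $n$.
   Context: For $\alpha>0$ and $m\in\mathbb Z$ let $\ell_m=(|m|+2^{1/\alpha})^{-\alpha}$. The Slicer Map $S_\alpha:[0,1]\times\mathbb Z\to[0,1]\times\mathbb Z$ is $S_\alpha(x,m)=(x,m-1)$ if $0\le x\le \ell_m$ or $\tfrac12<x\le 1-\ell_m$, and $S_\alpha(x,m)=(x,m+1)$ if $\ell_m<x\le\tfrac12$ or $1-\ell_m<x\le 1$. Initial conditions are $(x,0)$ with $x$ uniform in the right half of the unit interval. Put $\ell_k^+=1-\ell_k$ and $\Delta_k(\alpha)=\ell_k^+-\ell_{k-1}^+$ for $k\ge1$. The velocity (the increment $\pm1$ of the cell index at step $n$) of a particle with $x\in[\ell^+_{k-1},\ell^+_k)$ is, up to a null set of initial conditions, $v_k(n)=1$ if $n<k$ and $v_k(n)=-(-1)^{n-k}$ if $n\ge k$. The velocity moments are $\langle v^p(n)\rangle=2\sum_{k=1}^{\infty}v_k(n)^p\,\Delta_k(\alpha)$. *)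

(* Defs.v *)
From mathcomp Require Import all_boot all_order all_algebra.
From mathcomp Require Import all_classical all_reals all_analysis.
From mathcomp Require Import measurable_realfun.
From mathcomp Require Import ring lra zify.
Set Implicit Arguments.
Unset Strict Implicit.
Unset Printing Implicit Defensive.
Import Order.TTheory GRing.Theory Num.Theory numFieldNormedType.Exports.
Local Open Scope classical_set_scope.
Local Open Scope ring_scope.

Section Slicer.
Context {R : realType}.
Implicit Types (alpha x : R) (m : int) (n k p : nat).

Definition slicer_ell alpha m : R :=
  (`|m|%:~R + 2 `^ (1 / alpha)) `^ (- alpha).

(* The first coordinate is never modified, so the map is total on R * int; it
   is the identity on points whose first coordinate is outside [0, 1].
   As ell_m <= 1/2, the two tests are mutually exclusive. *)
Definition slicer alpha (z : R * int) : R * int :=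
  let: (x, m) := z in
  let l := slicer_ell alpha m in
  if (0 <= x <= l) || (1 / 2 < x <= 1 - l) then (x, m - 1)
  else if (l < x <= 1 / 2) || (1 - l < x <= 1) then (x, m + 1)
  else (x, m).

Definition slicer_position alpha x n : int := (iter n (slicer alpha) (x, 0)).2.

Definition slicer_velocity alpha x n : R :=
  (slicer_position alpha x n.+1 - slicer_position alpha x n)%:~R.

Lemma half_lt1 : (1 / 2 : R) < 1.
Proof. lra. Qed.

(* Average over the initial conditions (x, 0) with x uniform in [1/2, 1]; it is
   equal to the series 2 * \sum_(k >= 1) v_k(n)^p Delta_k by
   [velocity_moment_cvg]. *)
Definition velocity_moment alpha p n : \bar R :=
  ('E_(uniform_prob half_lt1)[(fun x => slicer_velocity alpha x n ^+ p)%R])%E.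

Definition slicer_ellp alpha k : R := 1 - slicer_ell alpha k.

Definition slicer_Delta alpha k : R :=
  slicer_ellp alpha k - slicer_ellp alpha k.-1.

(* The limit exists, see [is_cvg_slicer_R]. *)
Definition slicer_R alpha : R :=
  limn (fun N => \sum_(1 <= k < N) slicer_Delta alpha (2 * k)).

(* Velocity v_k(n) of the particles with initial position in the k-th interval
   ]ell^+_(k-1), ell^+_k], see [slicer_velocityE]. *)
Definition slicer_cell_velocity k n : R :=
  if (n < k)%N then 1 else - (-1) ^+ (n - k).

Lemma slicer_ell0 alpha : 0 < alpha -> slicer_ell alpha 0 = 1 / 2.
Proof.
move=> a0; rewrite /slicer_ell normr0 add0r -powRrM.
by rewrite mul1r mulrN mulVf ?gt_eqF// powR_inv1// mul1r.
Qed.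

Lemma slicer_ell_gt0 alpha m : 0 < slicer_ell alpha m.
Proof. by rewrite powR_gt0// ltr_wpDl ?powR_gt0// ler0z. Qed.

Lemma slicer_ell_lt alpha k : 0 < alpha ->
  slicer_ell alpha k.+1 < slicer_ell alpha k.
Proof.
move=> a0; rewrite /slicer_ell !powRN ltf_pV2 ?posrE ?powR_gt0
  ?ltr_wpDl ?powR_gt0 ?ler0z//.
apply: gt0_ltr_powR => //; rewrite ?nnegrE ?addr_ge0 ?ler0z ?powR_ge0//.
by rewrite ltrD2r ltr_int; lia.
Qed.

Lemma slicer_ell_cvg alpha : 0 < alpha ->
  (fun k : nat => slicer_ell alpha k) @ \oo --> (0 : R).
Proof.
move=> a0; apply/cvgrPdist_lt => e e0.
near=> k.
rewrite sub0r normrN gtr0_norm ?slicer_ell_gt0//.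
have -> : e = (e `^ (- alpha^-1)) `^ (- alpha).
  by rewrite -powRrM mulrNN mulVf ?gt_eqF// powRr1// ltW.
rewrite /slicer_ell !powRN ltf_pV2 ?posrE ?powR_gt0
  ?ltr_wpDl ?powR_gt0 ?invr_gt0 ?ler0z//.
apply: gt0_ltr_powR => //; rewrite ?nnegrE ?addr_ge0 ?ler0z ?powR_ge0
  ?invr_ge0 ?powR_ge0//.
rewrite -powRN (@lt_le_trans _ _ (k%:R))//; last by rewrite lerDl powR_ge0.
  by near: k; exact: nbhs_infty_gtr.
by rewrite powR_gt0.
Unshelve. all: by end_near.
Qed.

Lemma slicer_ell_le alpha : 0 < alpha ->
  {homo (fun k : nat => slicer_ell alpha k) : i j / (i <= j)%N >-> j <= i}.
Proof.
move=> a0 i j ij; elim: j ij => [|j IH]; first by rewrite leqn0 => /eqP ->.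
rewrite leq_eqVlt ltnS => /predU1P[-> //|/IH]; apply: le_trans.
exact/ltW/slicer_ell_lt.
Qed.

Lemma slicer_ellp_itv alpha k : 0 < alpha -> 1 / 2 <= slicer_ellp alpha k < 1.
Proof.
move=> a0; have := slicer_ell_le a0 (leq0n k); have := slicer_ell0 a0.
have := slicer_ell_gt0 alpha k; rewrite /slicer_ellp => ? ? ?.
by apply/andP; split; lra.
Qed.

Lemma slicer_ellp_le alpha : 0 < alpha ->
  {homo slicer_ellp alpha : i j / (i <= j)%N >-> i <= j}.
Proof. by move=> a0 i j ij; rewrite lerD2l lerN2; exact: slicer_ell_le. Qed.

Lemma slicer_right alpha x k : 0 < alpha -> slicer_ellp alpha k < x <= 1 ->
  slicer alpha (x, k%:Z) = (x, k.+1%:Z).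
Proof.
move=> a0; have := slicer_ellp_itv k a0; rewrite /slicer /slicer_ellp.
set l := slicer_ell _ _ => /andP[l1 l2] /andP[x1 x2].
have -> : (0 <= x <= l) = false by apply/negP => /andP[? ?]; lra.
have -> : (1 / 2 < x <= 1 - l) = false by apply/negP => /andP[? ?]; lra.
by rewrite x1 x2 orbT /= -addn1 PoszD.
Qed.

Lemma slicer_left alpha x k : 1 / 2 < x <= slicer_ellp alpha k.+1 ->
  slicer alpha (x, k.+1%:Z) = (x, k%:Z).
Proof.
rewrite /slicer /slicer_ellp => ->; rewrite orbT; congr pair; lia.
Qed.

Lemma iter_slicer alpha k x n : 0 < alpha ->
  slicer_ellp alpha k < x <= slicer_ellp alpha k.+1 ->
  iter n (slicer alpha) (x, 0) =
  (x, if (n <= k)%N then n%:Z else k.+1%:Z - (odd (n - k.+1))%:Z).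
Proof.
move=> a0 /andP[x1 x2].
have /andP[k1 k2] := slicer_ellp_itv k a0.
have /andP[k3 k4] := slicer_ellp_itv k.+1 a0.
have Rt j : (j <= k)%N -> slicer alpha (x, j%:Z) = (x, j.+1%:Z).
  move=> jk; apply: slicer_right => //.
  have := slicer_ellp_le a0 jk => ?; apply/andP; split; lra.
have Lt : slicer alpha (x, k.+1%:Z) = (x, k%:Z).
  by apply: slicer_left; apply/andP; split; lra.
elim: n => [|n IH]; first by rewrite leq0n.
rewrite iterS IH; have [nk|kn] := leqP n k.
  rewrite Rt//; case: (ltnP n k) => // kn.
  have -> : n = k by lia.
  by rewrite subnn subr0.
rewrite ltnNge ltnW// subSn// oddS.
case: (odd _).
  rewrite (_ : k.+1%:Z - true%:Z = k%:Z); last by lia.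
  by rewrite Rt//; congr pair; lia.
rewrite (_ : k.+1%:Z - false%:Z = k.+1%:Z); last by lia.
by rewrite Lt; congr pair; lia.
Qed.

(* The velocity is constant on ]ell^+_(k-1), ell^+_k]: because of the strict
   and large inequalities in [slicer], the left endpoint of the closed-open
   interval [ell^+_(k-1), ell^+_k[ is an exceptional point. *)
Lemma slicer_velocityE alpha k x n : 0 < alpha ->
  slicer_ellp alpha k < x <= slicer_ellp alpha k.+1 ->
  slicer_velocity alpha x n = slicer_cell_velocity k.+1 n.
Proof.
move=> a0 xk; rewrite /slicer_velocity /slicer_position !(iter_slicer _ a0 xk)/=.
rewrite /slicer_cell_velocity ltnS.
have [nk|kn] := leqP n k.
  have [nk'|kn] := ltnP n k; first by rewrite -[1]/(1%:~R); congr intmul; lia.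
  have -> : n = k by lia.
  by rewrite subnn -[1]/(1%:~R); congr intmul; lia.
rewrite ltnNge ltnW// subSn// oddS -signr_odd.
case: (odd _).
  by rewrite /negb expr1 opprK -[1]/(1%:~R); congr intmul; lia.
by rewrite /negb expr0 -[1]/(1%:~R) -mulrNz; congr intmul; lia.
Qed.

Lemma measurable_slicer_velocity alpha n :
  measurable_fun [set: R] (fun x => slicer_velocity alpha x n).
Proof.
pose q j x : R := (slicer_position alpha x j)%:~R.
suff mq j : measurable_fun [set: R] (q j).
  rewrite (_ : (fun _ => _) = q n.+1 \- q n).
    by apply: measurable_funB; exact: mq.
  by apply/funext => x; rewrite /q /slicer_velocity /= intrB.
elim: j => [|j IH]; first exact: measurable_cst.
pose l x : R := (`|q j x| + 2 `^ (1 / alpha)) `^ (- alpha).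
have ml : measurable_fun [set: R] l.
  rewrite /l; apply: (measurableT_comp (measurable_powR _)).
  apply: measurable_funD; last exact: measurable_cst.
  exact: measurableT_comp.
have m1l : measurable_fun [set: R] (fun x => 1 - l x).
  by apply: measurable_funB => //; exact: measurable_cst.
rewrite (_ : q j.+1 = fun x =>
  if (0 <= x <= l x) || (1 / 2 < x <= 1 - l x) then q j x - 1
  else if (l x < x <= 1 / 2) || (1 - l x < x <= 1) then q j x + 1
  else q j x); last first.
  apply/funext => x; rewrite /q /l /q /slicer_position iterS.
  have : (iter j (slicer alpha) (x, 0)).1 = x.
    elim: (j) => [//|i]; rewrite iterS /slicer.
    by case: (iter _ _ _) => y m /= ->; case: ifP => // _; case: ifP.
  case: (iter _ _ _) => y m /= ->; rewrite /slicer_ell -intr_norm.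
  case: ifP => _; first by rewrite /= intrB.
  by case: ifP => _ //=; rewrite intrD.
have C c := @measurable_cst _ _ R R setT (c : R).
have I := @measurable_id _ R setT.
apply: measurable_fun_if => //.
- by apply: measurable_or; apply: measurable_and;
    (apply: measurable_fun_ler || apply: measurable_fun_ltr).
- apply: measurable_funTS; apply: measurable_funB => //; exact: C.
apply: measurable_funTS; apply: measurable_fun_if => //.
- by apply: measurable_or; apply: measurable_and;
    (apply: measurable_fun_ler || apply: measurable_fun_ltr).
- apply: measurable_funTS; apply: measurable_funD => //; exact: C.
- exact: measurable_funTS.
Qed.

Lemma slicer_Delta_ge0 alpha k : 0 < alpha -> 0 <= slicer_Delta alpha k.
Proof.
by move=> a0; rewrite subr_ge0; apply: slicer_ellp_le => //; exact: leq_pred.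
Qed.

Lemma slicer_Delta_sum alpha N : 0 < alpha ->
  \sum_(0 <= k < N) slicer_Delta alpha k.+1 = slicer_ellp alpha N - 1 / 2.
Proof.
move=> a0; rewrite /slicer_Delta /= telescope_sumr//.
by rewrite {2}/slicer_ellp slicer_ell0//; lra.
Qed.

Lemma slicer_Delta_cvg alpha : 0 < alpha ->
  \sum_(0 <= k < N) slicer_Delta alpha k.+1 @[N --> \oo] --> (1 / 2 : R).
Proof.
move=> a0; under eq_fun do rewrite slicer_Delta_sum// /slicer_ellp.
have : (fun N : nat => 1 - slicer_ell alpha N - 1 / 2) @ \oo --> 1 - 0 - (1 / 2 : R).
  apply: cvgB; last exact: cvg_cst.
  by apply: cvgB; [exact: cvg_cst|exact: slicer_ell_cvg].
by rewrite (_ : 1 - 0 - (1 / 2 : R) = 1 / 2)//; lra.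
Qed.

Lemma is_cvg_slicer_R alpha : 0 < alpha ->
  cvgn (fun N => \sum_(1 <= k < N) slicer_Delta alpha (2 * k)).
Proof.
move=> a0; apply: nondecreasing_is_cvgn.
  apply/nondecreasing_seqP => -[|N]; first by rewrite !big_geq.
  by rewrite [leRHS]big_nat_recr//= lerDl slicer_Delta_ge0.
exists (1 / 2) => _ [N _ <-].
apply: (@le_trans _ _ (\sum_(1 <= k < N)
    (slicer_ellp alpha (2 * k) - slicer_ellp alpha (2 * k.-1)))).
  rewrite big_nat [leRHS]big_nat; apply: ler_sum => k k1.
  by rewrite lerD2l lerN2; apply: slicer_ellp_le => //; lia.
case: N => [|N]; first by rewrite big_geq//; lra.
rewrite big_add1/= telescope_sumr//.
have := slicer_ellp_itv (2 * N) a0; have := slicer_ellp_itv (2 * 0) a0.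
lra.
Qed.

Lemma uniform_prob_cell alpha k : 0 < alpha ->
  uniform_prob half_lt1 `]slicer_ellp alpha k, slicer_ellp alpha k.+1]%classic
  = (2 * slicer_Delta alpha k.+1)%:E.
Proof.
move=> a0.
have /andP[? ?] := slicer_ellp_itv k a0.
have /andP[? ?] := slicer_ellp_itv k.+1 a0.
have lt : slicer_ellp alpha k < slicer_ellp alpha k.+1.
  by rewrite ltrD2l ltrN2; exact: slicer_ell_lt.
rewrite /uniform_prob (eq_integral (fun=> 2%:E)).
  rewrite integral_cst//= lebesgue_measure_itv/= lte_fin lt.
  by rewrite -EFinD -EFinM.
move=> x; rewrite inE/= in_itv/= => /andP[? ?]; rewrite /uniform_pdf.
rewrite ifT; last by apply/andP; split; lra.
by congr EFin; rewrite -[RHS]invrK; congr GRing.inv; lra.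
Qed.

Lemma slicer_velocity_le1 alpha x n : `|slicer_velocity alpha x n| <= 1.
Proof.
rewrite /slicer_velocity /slicer_position iterS; case: (iter _ _ _) => y m /=.
by case: ifP => _; [|case: ifP => _] => /=;
  rewrite ?subrr ?normr0// addrAC subrr add0r ?normr1// mulrN1z normrN1.
Qed.

Lemma velocity_moment_cvg alpha p n : 0 < alpha ->
  (2 * \sum_(1 <= k < N) slicer_cell_velocity k n ^+ p * slicer_Delta alpha k)%:E
  @[N --> \oo] --> velocity_moment alpha p n.
Proof.
move=> a0; pose P : probability (measurableTypeR R) R := uniform_prob half_lt1.
pose F k : set (measurableTypeR R) := `]slicer_ellp alpha k, slicer_ellp alpha k.+1]%classic.
have mF k : measurable (F k) by exact: measurable_itv.
have PF k : P (F k) = (2 * slicer_Delta alpha k.+1)%:E by exact: uniform_prob_cell.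
have tF : trivIset setT F.
  apply/trivIsetP => i j _ _; wlog ij : i j / (i < j)%N.
    move=> W; rewrite neq_ltn => /orP[ij|ji].
      by apply: W => //; rewrite lt_eqF.
    by rewrite setIC; apply: W => //; rewrite lt_eqF.
  move=> _; rewrite -subset0 => x [/=]; rewrite /F/= !in_itv/= => /andP[_ xi] /andP[xj _].
  by have := slicer_ellp_le a0 ij; rewrite leNgt (lt_le_trans xj xi).
pose U := \bigcup_k F k.
have mU : measurable U by apply: bigcup_measurable => k _; exact: mF.
have PU : P U = 1%E.
  rewrite /U (measure_semi_bigcup P)//; apply/cvg_lim => //.
  rewrite (_ : (fun _ => _) = fun N =>
      (2 * \sum_(0 <= k < N) slicer_Delta alpha k.+1)%:E); last first.
    apply/funext => N; rewrite mulr_sumr -sumEFin.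
    by apply: eq_bigr => k _; exact: PF.
  apply/fine_cvgP; split; first exact: nearW.
  have := cvgM (cvg_cst (2 : R)) (slicer_Delta_cvg a0).
  have e : 2 * (1 / 2) = 1 :> R by lra.
  by rewrite e; exact.
pose f x := slicer_velocity alpha x n ^+ p.
have PUC : P (~` U) = 0%E by rewrite (probability_setC P mU) PU subee.
have mf : measurable_fun [set: R] f.
  by apply: measurable_funX; exact: measurable_slicer_velocity.
have If : P.-integrable [set: R] (EFin \o f).
  apply: measurable_bounded_integrable => //.
    by rewrite (le_lt_trans (probability_le1 P _))// ltry.
  exists 1; split=> // M M1 x _ /=.
  rewrite normrX (le_trans _ (ltW M1))// exprn_ile1//.
  exact: slicer_velocity_le1.
have IFk k : (\int[P]_(x in F k) (f x)%:E =
    (2 * (slicer_cell_velocity k.+1 n ^+ p * slicer_Delta alpha k.+1))%:E)%E.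
  rewrite (eq_integral (fun=> (slicer_cell_velocity k.+1 n ^+ p)%:E)).
    transitivity ((slicer_cell_velocity k.+1 n ^+ p)%:E * P (F k))%E.
      exact: integral_cst (mF k) _.
    by rewrite PF -EFinM mulrCA.
  by move=> x; rewrite inE /F /= in_itv /= /f => xk; rewrite (slicer_velocityE _ a0 xk).
have EU : velocity_moment alpha p n = (\sum_(i <oo) \int[P]_(x in F i) (f x)%:E)%E.
  rewrite /velocity_moment unlock.
  transitivity (\int[P]_(x in [set: measurableTypeR R] `\` ~` U) (f x)%:E)%E.
    exact: (negligible_integral (measurableC mU) _ If PUC).
  rewrite setTD setCK; apply: integral_bigcup => //.
  exact: integrableS If.
pose S N : R := \sum_(0 <= k < N)
  2 * (slicer_cell_velocity k.+1 n ^+ p * slicer_Delta alpha k.+1).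
have cS : cvgn S.
  apply: normed_cvg.
  apply: (@series_le_cvg _ _ (fun k => 2 * slicer_Delta alpha k.+1)).
  - by move=> k; exact: normr_ge0.
  - by move=> k; rewrite mulr_ge0// slicer_Delta_ge0.
  - move=> k /=; rewrite !normrM normrX (ger0_norm (slicer_Delta_ge0 _ a0)) ger0_norm//.
    rewrite ler_pM2l// ler_piMl ?slicer_Delta_ge0// exprn_ile1//.
    rewrite /slicer_cell_velocity; case: ifP => _; first by rewrite normr1.
    by rewrite normrN normrX normrN1 expr1n.
  rewrite /series/=; under eq_fun do rewrite -mulr_sumr.
  apply: is_cvgM; first exact: is_cvg_cst.
  by apply/cvg_ex; exists (1 / 2); exact: slicer_Delta_cvg.
have ES : EFin \o S @ \oo --> (limn S)%:E.
  by apply/fine_cvgP; split; [exact: nearW|exact: cS].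
have -> : velocity_moment alpha p n = (limn S)%:E.
  rewrite EU; apply/cvg_lim => //.
  rewrite (_ : (fun _ => _) = EFin \o S)//.
  by apply/funext => N; rewrite /S/= -sumEFin; apply: eq_bigr => k _; exact: IFk.
rewrite -cvg_shiftS/= (_ : (fun _ => _) = EFin \o S)//.
by apply/funext => N; rewrite /S /= big_add1 mulr_sumr.
Qed.

End Slicer.

(* Main.v *)
Require Import Defs.
From mathcomp Require Import all_boot all_order all_algebra.
From mathcomp Require Import all_classical all_reals all_analysis.
From mathcomp Require Import lra zify.
Import Order.TTheory GRing.Theory Num.Theory numFieldNormedType.Exports.
Local Open Scope classical_set_scope.
Local Open Scope ring_scope.

(** For even p every term of the velocity moment has v_k(n)^p = 1, and the
    widths Delta_k add up to 1/2.  For odd p, v_k(n)^p = v_k(n): the cells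
    k > n move to the right and have total width ell_n, while a cell k <= n
    contributes - (-1)^n (-1)^k Delta_k.  Hence the moment is exactly
    2 ell_n - 2 (-1)^n \sum_(k <= n) (-1)^k Delta_k, and the alternating sum
    tends to 2 R - 1/2. *)

Section Moments.
Context {R : realType} {alpha : R}.
Context (alpha_gt0 : 0 < alpha).
Implicit Types (k n p N : nat).

Lemma slicer_DeltaE k :
  slicer_Delta alpha k.+1 = slicer_ell alpha k - slicer_ell alpha k.+1.
Proof. rewrite /slicer_Delta /slicer_ellp /=; lra. Qed.

Lemma sum_slicer_Delta n N : (n <= N)%N ->
  \sum_(n.+1 <= k < N.+1) slicer_Delta alpha k =
  slicer_ell alpha n - slicer_ell alpha N.
Proof.
move=> nN; rewrite big_add1 /= (telescope_sumr (slicer_ellp alpha))//.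
by rewrite /slicer_ellp; lra.
Qed.

(** By [velocity_moment_cvg] the same partial sums tend to the moment in the extended reals, where
    limits are unique. The bound [N.+1] makes the sum end at the cell [N]. *)
Lemma velocity_moment_eq p n (l : R) :
  (2 * \sum_(1 <= k < N.+1)
     slicer_cell_velocity k n ^+ p * slicer_Delta alpha k) @[N --> \oo] --> l ->
  velocity_moment alpha p n = l%:E.
Proof.
move=> ul; apply/esym.
have := @velocity_moment_cvg R alpha p n alpha_gt0; rewrite -cvg_shiftS => /cvg_lim <-//.
apply/esym/cvg_lim => //.
by apply/fine_cvgP; split; [exact: nearW|exact: ul].
Qed.

(** A velocity is a sign, so its powers depend only on the parity of the exponent. *)
Lemma slicer_cell_velocity_even k n p : ~~ odd p ->
  slicer_cell_velocity k n ^+ p = 1 :> R.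
Proof.
move=> ep; rewrite /slicer_cell_velocity; case: ifP => _; first exact: expr1n.
by rewrite -signr_odd; case: (odd _); rewrite ?expr1 ?expr0 ?opprK ?expr1n//
  -signr_odd (negbTE ep).
Qed.

Lemma slicer_cell_velocity_odd k n p : odd p ->
  slicer_cell_velocity k n ^+ p = slicer_cell_velocity k n :> R.
Proof.
move=> op; rewrite /slicer_cell_velocity; case: ifP => _; first exact: expr1n.
by rewrite -signr_odd; case: (odd _); rewrite ?expr1 ?expr0 ?opprK ?expr1n//
  -signr_odd op.
Qed.

Lemma velocity_moment_even p n : ~~ odd p -> velocity_moment alpha p n = 1%E.
Proof.
move=> ep; apply: velocity_moment_eq.
under eq_fun do under eq_bigr do rewrite slicer_cell_velocity_even// mul1r.
under eq_fun do rewrite big_add1 /=.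
have := cvgM (cvg_cst (2 : R)) (slicer_Delta_cvg alpha_gt0).
have e : 2 * (1 / 2) = 1 :> R by lra.
by rewrite e; exact.
Qed.

Definition alternating_Delta n : R :=
  \sum_(1 <= k < n.+1) (-1) ^+ k * slicer_Delta alpha k.

Lemma velocity_moment_odd p n : odd p -> velocity_moment alpha p n =
  (2 * slicer_ell alpha n - 2 * (-1) ^+ n * alternating_Delta n)%:E.
Proof.
move=> op; apply: velocity_moment_eq.
apply: (@cvg_trans _ ((2 * (slicer_ell alpha n - slicer_ell alpha N)
    - 2 * (-1) ^+ n * alternating_Delta n) @[N --> \oo])).
  (* Once [N] is at least [n], the sum splits after the cell [n]: the cells beyond it have velocity
     1 and their widths telescope, the others form the alternating sum. *)
  apply: near_eq_cvg; near=> N.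
  have nN : (n <= N)%N by near: N; exact: nbhs_infty_ge.
  rewrite (big_cat_nat (n := n.+1))//= [RHS]mulrDr [RHS]addrC; congr (_ + _).
    congr (2 * _); rewrite -sum_slicer_Delta// [LHS]big_nat [RHS]big_nat.
    apply: eq_bigr => k /andP[nk _].
    by rewrite slicer_cell_velocity_odd// /slicer_cell_velocity nk mul1r.
  rewrite -mulrA -mulrN; congr (2 * _).
  rewrite /alternating_Delta mulr_sumr -sumrN [LHS]big_nat [RHS]big_nat.
  apply: eq_bigr => k /andP[_ kn].
  rewrite slicer_cell_velocity_odd// /slicer_cell_velocity ltnNge -ltnS kn /=.
  rewrite mulrA mulNr; congr (- (_ * _)).
  (* The exponents [n - k] and [n + k] have the same parity. *)
  by rewrite -exprD -[LHS]signr_odd -[RHS]signr_odd oddB// oddD.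
apply: cvgB; last exact: cvg_cst.
apply: cvgM; first exact: cvg_cst.
rewrite -[X in _ --> X]subr0.
by apply: cvgB; [exact: cvg_cst|exact: slicer_ell_cvg].
Unshelve. all: by end_near.
Qed.

(** As (-1)^k is -1 plus twice the indicator of even k, the alternating sum is minus the telescoping
    sum of all widths plus twice the sum of the even ones. The induction adds two cells at a
    time. *)
Lemma alternating_Delta_double n : alternating_Delta (2 * n) =
  slicer_ell alpha (2 * n)%N - 1 / 2
  + 2 * \sum_(1 <= k < n.+1) slicer_Delta alpha (2 * k).
Proof.
rewrite /alternating_Delta; elim: n => [|n IH].
  by rewrite muln0 !big_geq// slicer_ell0//; lra.
rewrite [in RHS]big_nat_recr//= mulnS add2n.
rewrite [LHS]big_nat_recr//= [X in X + _ = _]big_nat_recr//= IH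
  !exprS exprM sqrrN expr1n expr1n.
rewrite !slicer_DeltaE; lra.
Qed.

(** Monotonicity of [slicer_ell] squeezes the sequence between 0 and [slicer_ell alpha n]. *)
Lemma slicer_ell_subseq_cvg (f : nat -> nat) : (forall n, (n <= f n)%N) ->
  slicer_ell alpha (f n) @[n --> \oo] --> (0 : R).
Proof.
move=> nf; apply: (squeeze_cvgr _ (cvg_cst 0) (slicer_ell_cvg alpha_gt0)).
by apply: nearW => n; rewrite ltW ?slicer_ell_gt0//= slicer_ell_le.
Qed.

Lemma alternating_Delta_double_cvg :
  alternating_Delta (2 * n) @[n --> \oo] --> 2 * slicer_R alpha - 1 / 2.
Proof.
under eq_fun do rewrite alternating_Delta_double.
rewrite (_ : _ - _ = 0 - 1 / 2 + 2 * slicer_R alpha); last by lra.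
apply: cvgD.
  apply: cvgB; last exact: cvg_cst.
  by apply: slicer_ell_subseq_cvg => n; lia.
apply: cvgM; first exact: cvg_cst.
(* [cvgn] states convergence to the sequence's own limit, here [slicer_R]; the shift matches the
   upper bound [n.+1]. *)
have := is_cvg_slicer_R alpha_gt0; rewrite -/(slicer_R alpha) -cvg_shiftS.
exact.
Qed.

End Moments.

Theorem mainTheorem7 (R : realType) (alpha : R) (p : nat)
  (alpha_gt0 : 0 < alpha) (p_ge1 : (1 <= p)%N) :
  ((2 <= p)%N -> ~~ odd p ->
     velocity_moment alpha p n @[n --> \oo] --> 1%E) /\
  (odd p ->
     velocity_moment alpha p (2 * n)%N @[n --> \oo]
       --> (1 - 4 * slicer_R alpha)%:E /\
     velocity_moment alpha p (2 * n).+1 @[n --> \oo]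
       --> (- 1 + 4 * slicer_R alpha)%:E).
Proof.
have ell_cvg := slicer_ell_subseq_cvg alpha_gt0.
have alt_cvg := alternating_Delta_double_cvg alpha_gt0.
split=> [_ ep | op].
  by under eq_fun do rewrite velocity_moment_even//; exact: cvg_cst.
split; under eq_fun do rewrite velocity_moment_odd//;
  apply/fine_cvgP; split; try exact: nearW.
(* At even times the sign in front of the alternating sum is 1. *)
- rewrite /comp /=; under eq_fun do rewrite exprM sqrrN !expr1n mulr1.
  rewrite (_ : 1 - _ = 2 * 0 - 2 * (2 * slicer_R alpha - 1 / 2)); last by lra.
  apply: cvgB; apply: cvgM => //; try exact: cvg_cst.
  by apply: (ell_cvg (fun n => 2 * n)%N) => n; lia.
rewrite /comp /=.
(* At odd times the last cell is split off, which leaves the alternating sum at [2 * n], whose limit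
   is known, and terms in [slicer_ell] that vanish. *)
have E n : 2 * slicer_ell alpha (2 * n).+1
    - 2 * (-1) ^+ (2 * n).+1 * @alternating_Delta R alpha (2 * n).+1
    = 4 * slicer_ell alpha (2 * n).+1 - 2 * slicer_ell alpha (2 * n)%N
      + 2 * @alternating_Delta R alpha (2 * n).
  rewrite /alternating_Delta [in LHS]big_nat_recr//= exprS exprM sqrrN !expr1n.
  by rewrite slicer_DeltaE; lra.
under eq_fun do rewrite E.
rewrite (_ : _ + _ = 4 * 0 - 2 * 0 + 2 * (2 * slicer_R alpha - 1 / 2)); last by lra.
apply: cvgD; last by apply: cvgM => //; exact: cvg_cst.
apply: cvgB; (apply: cvgM; first exact: cvg_cst).
  by apply: (ell_cvg (fun n => (2 * n).+1)) => n; lia.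
by apply: (ell_cvg (fun n => 2 * n)%N) => n; lia.
Qed.
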